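(* Let $M\subseteq\mathbb{R}^d$ be nonempty. Then $$\mathcal{E}(M)^c=\overline{\mathcal{S}(M^c)}\cup\overline{\mathcal{F}(M)}=\overline{\mathcal{S}\big((\overline{M})^c\big)}\cup\overline{\mathcal{F}(M)},$$ where $\mathcal{F}(M)$ is the set of points $x\in\mathbb{R}^d$ for which there is no nearest point to $x$ in $M$.
   Context: Complements $(\cdot)^c$ and closures $\overline{(\cdot)}$ are taken in $\mathbb{R}^d$. $d(x,M)=\inf_{\xi\in M}\|x-\xi\|$ (Euclidean norm). A nearest point to $x$ in $M$ is a $\xi\in M$ with $\|x-\xi\|=d(x,M)$. $\operatorname{unpp}(M)$ is the set of $x\in\mathbb{R}^d$ for which there is exactly one nearest point in $M$. $\mathcal{E}(M)$ is the interior of $\operatorname{unpp}(M)$. $B_r(x)$ is the open ball with center $x$ and radius $r$. For $A\subseteq\mathbb{R}^d$, a ball $B_r(x)$ with $r\in(0,\infty)$ is maximal in $A$ if $B_r(x)\subseteq A$ and, whenever $x'\in\mathbb{R}^d$, $r'\in(0,\infty)$ and $B_r(x)\subseteq B_{r'}(x')\subseteq A$, then $r'=r$ and $x'=x$. The topological skeleton is $\mathcal{S}(A):=\{x\in\mathbb{R}^d:\exists r\in(0,\infty)\text{ such that }B_r(x)\text{ is maximal in }A\}$. *)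

(* Defs.v *)
From HB Require Import structures.
From mathcomp Require Import all_boot all_order all_algebra.
From mathcomp Require Import all_classical all_reals.
From mathcomp Require Import topology normedtype.

Set Implicit Arguments.
Unset Strict Implicit.
Unset Printing Implicit Defensive.

Import Order.TTheory GRing.Theory Num.Theory numFieldNormedType.Exports.

Local Open Scope classical_set_scope.
Local Open Scope ring_scope.

(* R^d is 'rV[R]_d for R : realType.  The library's norm `|x| and balls on
   'rV[R]_d are those of the sup norm, hence the Euclidean norm and balls below.
   [closure] and [interior] are the library's; its topology on 'rV[R]_d is the
   Euclidean one, see [nbhs_eball]. *)

Section Skeleton.
Context {R : realType} {d : nat}.
Implicit Types (x xi : 'rV[R]_d) (r : R) (M A : set 'rV[R]_d).

Definition enorm x : R := Num.sqrt (\sum_(i < d) x 0 i ^+ 2).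

Definition eball x r : set 'rV[R]_d := [set y | enorm (x - y) < r].

(* Only meaningful for M nonempty: [inf] of the empty set is 0 by convention. *)
Definition edist x M : R := inf [set enorm (x - xi) | xi in M].

Definition nearest_point M x xi : Prop := M xi /\ enorm (x - xi) = edist x M.

Definition unpp M : set 'rV[R]_d := [set x | exists! xi, nearest_point M x xi].

Definition unpp_interior M : set 'rV[R]_d := interior (unpp M).

Definition no_nearest_point M : set 'rV[R]_d :=
  [set x | ~ exists xi, nearest_point M x xi].

Definition maximal_ball A x r : Prop :=
  eball x r `<=` A /\
  forall x' r', 0 < r' -> eball x r `<=` eball x' r' -> eball x' r' `<=` A ->
    r' = r /\ x' = x.

Definition skeleton A : set 'rV[R]_d :=
  [set x | exists r, 0 < r /\ maximal_ball A x r].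

Lemma normr_le_enorm x : `|x| <= enorm x.
Proof.
have -> : `|x| = mx_norm x by [].
rewrite mx_normrE; apply/bigmax_leP; split=> [|[i j] _ /=].
  exact: sqrtr_ge0.
rewrite ord1 -sqrtr_sqr ler_wsqrtr // (bigD1 j) //=.
by rewrite lerDl sumr_ge0 // => k _; rewrite sqr_ge0.
Qed.

Lemma enorm_le_normr x : enorm x <= d%:R * `|x|.
Proof.
have xi i : `|x 0 i| <= `|x|.
  have -> : `|x| = mx_norm x by [].
  by rewrite mx_normrE (le_bigmax _ (fun k => `|x k.1 k.2|) (0, i)).
rewrite -[leRHS]ger0_norm ?mulr_ge0 // -sqrtr_sqr ler_wsqrtr // exprMn.
apply: (@le_trans _ _ (d%:R * `|x| ^+ 2)).
  rewrite mulr_natl -[X in _ *+ X]card_ord -sumr_const.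
  by apply: ler_sum => i _; rewrite -real_normK ?num_real // lerXn2r ?nnegrE.
rewrite ler_wpM2r ?sqr_ge0 // -natrX ler_nat.
by rewrite -mulnn; case: (d) => // n; rewrite leq_pmulr.
Qed.

Lemma nbhs_eball x A : nbhs x A <-> exists2 r, 0 < r & eball x r `<=` A.
Proof.
split => [/nbhs_ballP[r /= r0 rA]|[r r0 rA]].
  exists r => // y xy; apply: rA; rewrite -ball_normE /=.
  exact: le_lt_trans (normr_le_enorm _) xy.
apply/nbhs_ballP; exists (r / d.+1%:R) => /=; first by rewrite divr_gt0.
move=> y; rewrite -ball_normE /= ltr_pdivlMr // => xy; apply: rA => /=.
apply: le_lt_trans (enorm_le_normr _) (le_lt_trans _ xy).
by rewrite mulrC ler_wpM2l // ler_nat.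
Qed.

End Skeleton.

(* Main.v *)
(* A point with two distinct nearest points is the center of a maximal ball, so
   the complement of unpp(M) lies in the union of S(~M) and F(M).

   Conversely let x, at distance r > 0 from M, be interior to unpp(M).  Near x
   the nearest points in the closure K of M are unique, for if q in K is nearest
   to y, then q is the only nearest point in K of the points of the segment
   from y to q other than y, and as those near y have one in M, q is in M.
   Hence near x the distance f to K increases at rate
   1 away from the nearest point.  For c < 1 a maximizer of f - c |. - x| on a
   small closed ball of center x and radius s must then lie on the sphere, and
   letting c tend to 1 gives y with |y - x| = s and f(y) = r + s.  The ball of
   center y and radius r + s avoids M and contains the one of center x and
   radius r, which is thus not maximal. *)

Require Import Defs.
From mathcomp Require Import all_boot all_order all_algebra.
From mathcomp Require Import all_classical all_reals.
From mathcomp Require Import topology normedtype derive.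
From mathcomp Require Import ring lra.

Import Order.TTheory GRing.Theory Num.Theory numFieldNormedType.Exports.
(* normedtype also has an [edist]; the one meant here is that of Defs. *)
Import Defs.

Local Open Scope classical_set_scope.
Local Open Scope ring_scope.

Set Implicit Arguments.
Unset Strict Implicit.
Unset Printing Implicit Defensive.

(** * Euclidean inner product and norm *)

Definition edot (R : realType) (d : nat) (u v : 'rV[R]_d) : R :=
  \sum_(i < d) u 0 i * v 0 i.

Lemma edotC (R : realType) (d : nat) (u v : 'rV[R]_d) : edot u v = edot v u.
Proof. by apply: eq_bigr => i _; rewrite mulrC. Qed.

Lemma edotBr (R : realType) (d : nat) (u v w : 'rV[R]_d) :
  edot u (v - w) = edot u v - edot u w.
Proof. by rewrite /edot -sumrB; apply: eq_bigr => i _; rewrite !mxE; ring. Qed.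

Lemma enorm_ge0 (R : realType) (d : nat) (u : 'rV[R]_d) : 0 <= enorm u.
Proof. exact: sqrtr_ge0. Qed.

Lemma enorm_sqr (R : realType) (d : nat) (u : 'rV[R]_d) :
  enorm u ^+ 2 = edot u u.
Proof.
rewrite sqr_sqrtr; last by apply: sumr_ge0 => i _; exact: sqr_ge0.
by apply: eq_bigr => i _; rewrite expr2.
Qed.

Lemma enorm_eq0 (R : realType) (d : nat) (u : 'rV[R]_d) :
  enorm u = 0 -> u = 0.
Proof.
by move=> u0; apply/eqP; rewrite -normr_le0 -u0; exact: normr_le_enorm.
Qed.

Lemma enorm0 (R : realType) (d : nat) : enorm (0 : 'rV[R]_d) = 0.
Proof. by rewrite /enorm big1 ?sqrtr0 // => i _; rewrite mxE expr0n. Qed.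

Lemma enorm_gt0 (R : realType) (d : nat) (u : 'rV[R]_d) :
  u != 0 -> 0 < enorm u.
Proof.
move=> u0; rewrite lt_def enorm_ge0 andbT; apply: contra_neq u0.
exact: enorm_eq0.
Qed.

Lemma enormDZ_sqr (R : realType) (d : nat) (u v : 'rV[R]_d) (t : R) :
  enorm (u + t *: v) ^+ 2 =
    enorm u ^+ 2 + 2 * t * edot u v + t ^+ 2 * enorm v ^+ 2.
Proof.
rewrite !enorm_sqr /edot !mulr_sumr -!big_split /=.
by apply: eq_bigr => i _; rewrite !mxE; ring.
Qed.

Lemma enormZ (R : realType) (d : nat) (t : R) (u : 'rV[R]_d) :
  enorm (t *: u) = `|t| * enorm u.
Proof.
rewrite /enorm -sqrtr_sqr -sqrtrM ?sqr_ge0 // mulr_sumr.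
by congr Num.sqrt; apply: eq_bigr => i _; rewrite mxE exprMn.
Qed.

(** Cauchy-Schwarz, by expanding the squared norm of [u - (enorm u / enorm v) *: v]. *)
Lemma edot_le_enorm (R : realType) (d : nat) (u v : 'rV[R]_d) :
  edot u v <= enorm u * enorm v.
Proof.
have [->|/enorm_gt0 u0] := eqVneq u 0.
  by rewrite enorm0 mul0r /edot big1 // => i _; rewrite mxE mul0r.
have [->|/enorm_gt0 v0] := eqVneq v 0.
  by rewrite enorm0 mulr0 /edot big1 // => i _; rewrite mxE mulr0.
have := enormDZ_sqr u v (- (enorm u / enorm v)).
have -> : (- (enorm u / enorm v)) ^+ 2 * enorm v ^+ 2 = enorm u ^+ 2.
  by field; rewrite gt_eqF.
move=> H; have := sqr_ge0 (enorm (u + - (enorm u / enorm v) *: v)).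
rewrite {}H.
have -> : enorm u ^+ 2 + 2 * - (enorm u / enorm v) * edot u v + enorm u ^+ 2
  = (2 * enorm u / enorm v) * (enorm u * enorm v - edot u v).
  by field; rewrite gt_eqF.
by rewrite pmulr_rge0 ?subr_ge0 // divr_gt0 // mulr_gt0.
Qed.

Lemma enormD (R : realType) (d : nat) (u v : 'rV[R]_d) :
  enorm (u + v) <= enorm u + enorm v.
Proof.
rewrite -ler_sqr ?nnegrE ?addr_ge0 ?enorm_ge0 //.
rewrite -{1}[v]scale1r enormDZ_sqr; have := edot_le_enorm u v; lra.
Qed.

Lemma enormN (R : realType) (d : nat) (u : 'rV[R]_d) : enorm (- u) = enorm u.
Proof. by rewrite -scaleN1r enormZ normrN1 mul1r. Qed.

Lemma enorm_distC (R : realType) (d : nat) (x y : 'rV[R]_d) :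
  enorm (x - y) = enorm (y - x).
Proof. by rewrite -enormN opprB. Qed.

Lemma enorm_distD (R : realType) (d : nat) (y x z : 'rV[R]_d) :
  enorm (x - z) <= enorm (x - y) + enorm (y - z).
Proof. by have := enormD (x - y) (y - z); rewrite addrA subrK. Qed.

(** * Continuity, and compactness of closed balls *)

(** A one-sided bound suffices, since [x] and [y] can be exchanged. *)
Lemma enorm_lipschitz_continuous (R : realType) (d : nat) (f : 'rV[R]_d -> R)
    (L : R) :
  (forall x y, f y <= f x + L * enorm (x - y)) -> continuous f.
Proof.
move=> fL x.
suff: forall e, 0 < e -> \forall y \near x, `|f x - f y| < e.
  by move=> H; apply/(@cvgrPdist_lt _ _ _ (nbhs x) (nbhs_filter x)).
move=> e e0.
have L1 : 0 < `|L| + 1 by rewrite ltr_wpDl.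
apply/nbhs_eball; exists (e / (`|L| + 1)); first by rewrite divr_gt0.
move=> y; rewrite /eball /= ltr_pdivlMr // => xy.
have := fL x y; have := fL y x; rewrite enorm_distC.
have : L * enorm (x - y) <= `|L| * enorm (x - y).
  by rewrite ler_wpM2r ?enorm_ge0 ?ler_norm.
have := enorm_ge0 (x - y); rewrite ltr_norml; lra.
Qed.

Lemma enorm_dist_continuous (R : realType) (d : nat) (x : 'rV[R]_d) :
  continuous (fun y : 'rV[R]_d => enorm (x - y)).
Proof.
apply: (@enorm_lipschitz_continuous _ _ _ 1) => y z.
by rewrite mul1r; exact: enorm_distD.
Qed.

Lemma edot_continuous (R : realType) (d : nat) (u x : 'rV[R]_d) :
  continuous (fun y : 'rV[R]_d => edot u (x - y)).
Proof.
apply: (@enorm_lipschitz_continuous _ _ _ (enorm u)) => y z.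
have -> : edot u (x - z) = edot u (x - y) + edot u (y - z).
  by rewrite !edotBr; ring.
by rewrite lerD2l; exact: edot_le_enorm.
Qed.

Definition ecball (R : realType) (d : nat) (x : 'rV[R]_d) (r : R) :
  set 'rV[R]_d := [set y | enorm (x - y) <= r].

Lemma ecball_closed (R : realType) (d : nat) (x : 'rV[R]_d) (r : R) :
  closed (ecball x r).
Proof.
have -> : ecball x r =
  (fun y : 'rV[R]_d => enorm (x - y)) @^-1` [set t | t <= r] by [].
apply: closed_comp; last exact: closed_le.
by move=> y _; exact: enorm_dist_continuous.
Qed.

Lemma ecball_compact (R : realType) (d : nat) (x : 'rV[R]_d) (r : R) :
  compact (ecball x r).
Proof.
apply: bounded_closed_compact (@ecball_closed _ _ x r).
exists (enorm x + r); split; first exact: num_real.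
move=> s rs y /= xy; apply/ltW; apply: le_lt_trans (normr_le_enorm _) _.
apply: le_lt_trans rs; rewrite -[y](subKr x).
by apply: le_trans (enormD _ _) _; rewrite enormN lerD2l.
Qed.

(** * Distance to a set and nearest points *)

Lemma edist_le (R : realType) (d : nat) (M : set 'rV[R]_d) (x xi : 'rV[R]_d) :
  M xi -> edist x M <= enorm (x - xi).
Proof.
move=> Mxi; apply: ge_inf; last by exists xi.
by exists 0 => _ [y _ <-]; exact: enorm_ge0.
Qed.

Lemma le_edist (R : realType) (d : nat) (M : set 'rV[R]_d) (x : 'rV[R]_d)
    (r : R) :
  M !=set0 -> (forall xi, M xi -> r <= enorm (x - xi)) -> r <= edist x M.
Proof.
move=> [p Mp] rM; apply: lb_le_inf; first by exists (enorm (x - p)), p.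
by move=> _ [xi Mxi <-]; exact: rM.
Qed.

Lemma edist_lipschitz (R : realType) (d : nat) (M : set 'rV[R]_d)
    (x y : 'rV[R]_d) :
  M !=set0 -> edist y M <= edist x M + enorm (x - y).
Proof.
move=> M0; rewrite -lerBlDr; apply: le_edist => // xi Mxi.
rewrite lerBlDr; apply: le_trans (edist_le y Mxi) _.
by rewrite [leRHS]addrC [enorm (x - y)]enorm_distC; exact: enorm_distD.
Qed.

Lemma edist_closure (R : realType) (d : nat) (M : set 'rV[R]_d)
    (x : 'rV[R]_d) :
  M !=set0 -> edist x (closure M) = edist x M.
Proof.
move=> M0; have [p Mp] := M0; apply/eqP; rewrite eq_le; apply/andP; split.
  by apply: le_edist => // xi Mxi; apply: edist_le; exact: subset_closure.
apply: le_edist; first by exists p; exact: subset_closure.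
move=> xi cMxi; apply/ler_addgt0Pr => e e0.
have [|q [Mq qe]] := cMxi (eball xi e); first by apply/nbhs_eball; exists e.
apply: le_trans (edist_le x Mq) (le_trans (enorm_distD xi _ _) _).
by rewrite lerD2l ltW.
Qed.

(** Only the points of [K] no farther from [x] than a given [q] matter, and they form a compact
    set. *)
Lemma nearest_point_exists (R : realType) (d : nat) (K : set 'rV[R]_d)
    (x : 'rV[R]_d) :
  closed K -> K !=set0 -> exists xi, nearest_point K x xi.
Proof.
move=> cK [q Kq]; set B := ecball x (enorm (x - q)) `&` K.
have [||| p] := @compact_EVT_min _ R (fun y : 'rV[R]_d => enorm (x - y)) B.
- by exists q; split=> //; rewrite /ecball /=.
- exact: compact_closedI (@ecball_compact _ _ _ _) cK.
- exact/continuous_subspaceT/enorm_dist_continuous.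
rewrite inE => -[_ Kp] pmin; exists p; split=> //.
apply/eqP; rewrite eq_le edist_le // andbT; apply: le_edist; first by exists q.
move=> xi Kxi; have [xiq|/ltW qxi] := lerP (enorm (x - xi)) (enorm (x - q)).
  by apply: pmin; rewrite inE.
by apply: le_trans qxi; apply: pmin; rewrite inE; split=> //; rewrite /ecball /=.
Qed.

(** * Uniqueness of nearest points and growth of the distance *)

(** The closed ball around a point of the segment from [x] to [q], with [q] on its boundary, touches
    the sphere around [x] through [q] from inside, and only at [q]. In formulas, expanding both
    squared norms yields [t * enorm (q - p) ^+ 2 <= 0]. *)
Lemma dist_segment_eq (R : realType) (d : nat) (x p q : 'rV[R]_d) (t : R) :
  0 < t -> t <= 1 -> enorm (x - q) <= enorm (x - p) ->
  enorm (x + t *: (q - x) - p) <= (1 - t) * enorm (x - q) -> p = q.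
Proof.
move=> t0 t1 xqp; rewrite -ler_sqr ?nnegrE ?mulr_ge0 ?enorm_ge0 ?subr_ge0 //.
have -> : x + t *: (q - x) - p = (x - p) + t *: (q - x) by rewrite addrAC.
rewrite enormDZ_sqr [enorm (q - x)]enorm_distC => yp.
have := enormDZ_sqr (x - p) (q - x) 1.
have -> : x - p + 1 *: (q - x) = q - p.
  by apply/rowP => i; rewrite !mxE; ring.
rewrite [enorm (q - x)]enorm_distC => qp.
have : enorm (x - q) ^+ 2 <= enorm (x - p) ^+ 2.
  by rewrite ler_sqr ?nnegrE ?enorm_ge0.
move=> sxqp; have : t * enorm (q - p) ^+ 2 <= 0.
  have := sqr_ge0 (enorm (x - q)); nra.
rewrite pmulr_rle0 // => qp0; apply/esym/eqP; rewrite -subr_eq0.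
apply/eqP/enorm_eq0/eqP; rewrite -sqrf_eq0; apply/eqP/le_anti.
by rewrite qp0 sqr_ge0.
Qed.

Lemma unpp_interior_nearest_closure (R : realType) (d : nat)
    (M : set 'rV[R]_d) (x q : 'rV[R]_d) :
  M !=set0 -> unpp_interior M x ->
  nearest_point (closure M) x q -> nearest_point M x q.
Proof.
move=> M0 /nbhs_eball[e e0 xM] [cMq]; rewrite edist_closure // => xq.
split=> //.
have D0 := enorm_ge0 (x - q).
(* This keeps [t * enorm (x - q)] below [e]; the [+ 1] covers [x = q]. *)
pose t := Num.min 1 (e / (2 * (enorm (x - q) + 1))).
have D1 : 0 < 2 * (enorm (x - q) + 1) by lra.
have t0 : 0 < t by rewrite lt_min ltr01 divr_gt0.
have t1 : t <= 1 by rewrite ge_min lexx.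
have te : t * (2 * (enorm (x - q) + 1)) <= e.
  by rewrite -ler_pdivlMr // ge_min lexx orbT.
pose y := x + t *: (q - x).
have xy : enorm (x - y) = t * enorm (x - q).
  have -> : x - y = t *: (x - q) by apply/rowP => i; rewrite !mxE; ring.
  by rewrite enormZ gtr0_norm.
have [|p [[Mp yp] _]] := xM y; first by rewrite /eball /= xy; nra.
rewrite -(@dist_segment_eq _ _ x p q t) //.
  by rewrite xq; exact: edist_le.
rewrite -/y yp -edist_closure //; apply: le_trans (edist_le _ cMq) _.
have -> : y - q = (1 - t) *: (x - q) by apply/rowP => i; rewrite !mxE; ring.
by rewrite enormZ ger0_norm // subr_ge0.
Qed.

(* Take z = x + t (x - p): as p is unique, the nearest points of z tend to p as
   t -> 0, so the distance to K grows at rate 1 from x to z. *)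
Lemma edist_ascent (R : realType) (d : nat) (K : set 'rV[R]_d)
    (x p : 'rV[R]_d) (c e : R) :
  closed K -> nearest_point K x p ->
  (forall q, nearest_point K x q -> q = p) -> 0 < edist x K ->
  0 <= c -> c < 1 -> 0 < e ->
  exists z, enorm (x - z) < e /\ edist x K + c * enorm (x - z) < edist z K.
Proof.
move=> cK [Kp xp] uniq_p; set r := edist x K in xp * => r0 c0 c1 e0.
set v := x - p in xp.
have r2 : 0 < r ^+ 2 by rewrite exprn_gt0.
(* The points of [K] from which a move along [v] leads away too slowly. This set is closed and omits
   [p], for which the product is [r ^+ 2], so its distance to [x] exceeds [r] by some [h]. *)
pose K' := K `&` [set q | edot v (x - q) <= c * r ^+ 2].
have cK' : closed K'.
  apply: closedI => //.
  have -> : [set q | edot v (x - q) <= c * r ^+ 2] =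
    (fun q => edot v (x - q)) @^-1` [set s | s <= c * r ^+ 2] by [].
  apply: closed_comp; last exact: closed_le.
  by move=> y _; exact: edot_continuous.
have [h h0 hK'] : exists2 h, 0 < h & forall q, K' q -> r + h <= enorm (x - q).
  have [K'0|/set0P/negP/negPn/eqP K'0] := pselect (K' !=set0); last first.
    by exists 1 => // q; rewrite K'0.
  have [p' [K'p' xp']] := nearest_point_exists x cK' K'0.
  exists (enorm (x - p') - r); last first.
    by move=> q K'q; rewrite addrC subrK xp'; exact: edist_le.
  rewrite subr_gt0 ltNge; apply/negP => p'r.
  have p'p : p' = p.
    apply: uniq_p; split; first by case: K'p'.
    by apply/eqP; rewrite eq_le p'r; apply: edist_le; case: K'p'.
  by case: K'p' => _ /=; rewrite p'p -enorm_sqr xp; nra.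
(* The factor 3 gives [t * r < e] and [2 * (t * r) < h]; the latter puts a nearest point [q] of [z]
   within less than [r + h] of [x], hence outside [K']. *)
pose m := Num.min e h; pose t := m / (3 * r).
have m0 : 0 < m by rewrite lt_min e0.
have me : m <= e by rewrite ge_min lexx.
have mh : m <= h by rewrite ge_min lexx orbT.
have t0 : 0 < t by rewrite divr_gt0 // mulr_gt0.
have tr : 3 * (t * r) = m by rewrite /t; field; rewrite gt_eqF.
pose z := x + t *: v.
have xz : enorm (x - z) = t * r.
  have -> : x - z = - (t *: v) by apply/rowP => i; rewrite !mxE; ring.
  by rewrite enormN enormZ gtr0_norm // xp.
exists z; rewrite xz; split; first lra.
have [q [Kq zq]] := nearest_point_exists z cK (ex_intro _ p Kp).
have zqr : enorm (z - q) <= t * r + r.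
  rewrite zq; apply: le_trans (edist_le z Kp) _.
  by rewrite -xz -xp [enorm (x - z)]enorm_distC; exact: enorm_distD.
have xqr : enorm (x - q) <= t * r + enorm (z - q).
  by rewrite -xz; exact: enorm_distD.
have vq : c * r ^+ 2 < edot v (x - q).
  rewrite ltNge; apply/negP => vq; have := hK' q (conj Kq vq); lra.
have rxq : r ^+ 2 <= enorm (x - q) ^+ 2.
  by rewrite ler_sqr ?nnegrE ?enorm_ge0 ?(ltW r0) //; exact: edist_le.
have tr0 : 0 <= t * r by rewrite mulr_ge0 // ltW.
(* In squares: [enorm (z - q) ^+ 2] exceeds [r ^+ 2 + 2 * t * (c * r ^+ 2) + t ^+ 2 * r ^+ 2], which
   is at least [(r + c * (t * r)) ^+ 2]. *)
rewrite -zq -ltr_sqr ?nnegrE ?enorm_ge0 ?addr_ge0 ?(mulr_ge0 c0 tr0) ?(ltW r0) //.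
have -> : z - q = (x - q) + t *: v by rewrite addrAC.
rewrite enormDZ_sqr xp edotC.
have : t * (c * r ^+ 2) < t * edot v (x - q) by rewrite ltr_pM2l.
have : (c * (t * r)) ^+ 2 <= t ^+ 2 * r ^+ 2.
  rewrite -exprMn ler_sqr ?nnegrE //; last exact: mulr_ge0.
  by rewrite ler_piMl // ltW.
lra.
Qed.

(* Maximizing edist y K - c |x - y| over the closed ball, [edist_ascent] pushes
   the maximizer to the sphere of radius s; then c tends to 1. *)
Lemma edist_ascent_ray (R : realType) (d : nat) (K : set 'rV[R]_d)
    (x : 'rV[R]_d) (s : R) :
  closed K -> K !=set0 -> 0 < s -> 0 < edist x K ->
  (forall y p q, ecball x s y -> nearest_point K y p -> nearest_point K y q ->
    p = q) ->
  exists y, y != x /\ edist x K + enorm (x - y) <= edist y K.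
Proof.
move=> cK K0 s0 r0 uniqK.
have max_ecball c : 0 <= c -> exists2 y, ecball x s y & forall z, ecball x s z ->
    edist z K - c * enorm (x - z) <= edist y K - c * enorm (x - y).
  move=> c0; have [||| y] := @compact_EVT_max _ R
    (fun y : 'rV[R]_d => edist y K - c * enorm (x - y)) (ecball x s).
  - by exists x; rewrite /ecball /= subrr enorm0 ltW.
  - exact: ecball_compact.
  - apply: continuous_subspaceT.
    apply: (@enorm_lipschitz_continuous _ _ _ (1 + c)) => y z.
    have := edist_lipschitz y z K0.
    have : c * enorm (x - y) <= c * (enorm (x - z) + enorm (y - z)).
      rewrite ler_wpM2l // [enorm (y - z)]enorm_distC; exact: enorm_distD.
    lra.
  by rewrite inE => By ymax; exists y => // z Bz; apply: ymax; rewrite inE.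
(* With [c = 0], [y] maximizes the distance itself over the ball. *)
have [y By ymax] := max_ecball 0 (lexx _).
have xmax : edist x K <= edist y K.
  have := ymax x; rewrite !mul0r !subr0; apply.
  by rewrite /ecball /= subrr enorm0 ltW.
suff sy : edist x K + s <= edist y K.
  exists y; split; last by apply: le_trans sy; rewrite lerD2l.
  by apply/eqP => yx; move: sy; rewrite yx; lra.
rewrite leNgt; apply/negP => ys.
(* Midway between 1 and the slope [(edist y K - edist x K) / s], which is below 1 by [ys]. A
   maximizer [w] for this [c] is not on the sphere: its distance to [K] would exceed that of [y]. *)
pose c := ((edist y K - edist x K) / s + 1) / 2.
have cs : c * s = (edist y K - edist x K + s) / 2.
  by rewrite /c; field; rewrite gt_eqF.
have c0 : 0 <= c by rewrite -(pmulr_lge0 _ s0) cs; lra.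
have c1 : c < 1 by rewrite -(ltr_pM2r s0) cs; lra.
have [w Bw wmax] := max_ecball c c0.
have xw : edist x K <= edist w K - c * enorm (x - w).
  have := wmax x; rewrite subrr enorm0 mulr0 subr0; apply.
  by rewrite /ecball /= subrr enorm0 ltW.
have ws : enorm (x - w) < s.
  rewrite lt_neqAle Bw andbT; apply/eqP => ws.
  have := ymax w Bw; rewrite !mul0r !subr0; move: xw; rewrite ws; lra.
have w0 : 0 < edist w K.
  have : 0 <= c * enorm (x - w) by rewrite mulr_ge0 ?enorm_ge0.
  lra.
have [p wp] := nearest_point_exists w cK K0.
have e0 : 0 < s - enorm (x - w) by lra.
have [|z [wz zK]] := edist_ascent cK wp _ w0 c0 c1 e0.
  by move=> q wq; exact: uniqK Bw wq wp.
have xz := enorm_distD w x z.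
have := wmax z; rewrite leNgt => /(_ _)/negP; apply.
  rewrite /ecball /=; lra.
have : c * enorm (x - z) <= c * (enorm (x - w) + enorm (w - z)).
  by rewrite ler_wpM2l.
lra.
Qed.

(** * Balls avoiding [M] and inclusion of balls *)

Lemma eball_subC (R : realType) (d : nat) (M : set 'rV[R]_d) (x : 'rV[R]_d)
    (r : R) :
  M !=set0 -> eball x r `<=` ~` M <-> r <= edist x M.
Proof.
move=> M0; split=> [xM|rM y xy My].
  apply: le_edist => // xi Mxi; rewrite leNgt; apply/negP => xxi.
  exact: xM xxi Mxi.
by have := lt_le_trans xy (le_trans rM (edist_le x My)); rewrite ltxx.
Qed.

Lemma eball_sub (R : realType) (d : nat) (x x' : 'rV[R]_d) (r r' : R) :
  enorm (x - x') + r <= r' -> eball x r `<=` eball x' r'.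
Proof.
move=> xr y; rewrite /eball /= => xy.
have := enorm_distD x x' y; rewrite [enorm (x' - x)]enorm_distC; lra.
Qed.

(** The vector [u] ensures that the dimension is positive: for [d = 0] all balls of positive radius
    coincide, whatever their radii. *)
Lemma eball_sub_inv (R : realType) (d : nat) (u x x' : 'rV[R]_d) (r r' : R) :
  u != 0 -> 0 < r -> eball x r `<=` eball x' r' -> enorm (x - x') + r <= r'.
Proof.
move=> u0 r0 xx'.
have [e e1 eD] : exists2 e : 'rV[R]_d, enorm e = 1 & x - x' = enorm (x - x') *: e.
  have [->|w0] := eqVneq (x - x') 0.
    exists ((enorm u)^-1 *: u); last by rewrite enorm0 scale0r.
    by rewrite enormZ ger0_norm ?invr_ge0 ?enorm_ge0 // mulVf // gt_eqF ?enorm_gt0.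
  have D0 : enorm (x - x') != 0 by rewrite gt_eqF ?enorm_gt0.
  exists ((enorm (x - x'))^-1 *: (x - x')).
    by rewrite enormZ ger0_norm ?invr_ge0 ?enorm_ge0 // mulVf.
  by rewrite scalerA mulfV // scale1r.
rewrite leNgt; apply/negP => rD.
(* Then [x + s *: e] is in the ball around [x], but at distance [enorm (x - x') + s >= r'] from
   [x']. *)
pose s := Num.max 0 (r' - enorm (x - x')).
have s0 : 0 <= s by rewrite le_max lexx.
have sr' : r' - enorm (x - x') <= s by rewrite le_max lexx orbT.
have sr : s < r by rewrite gt_max r0; lra.
have /xx' : eball x r (x + s *: e).
  have xE : x - (x + s *: e) = - (s *: e) by rewrite opprD addNKr.
  by rewrite /eball /= xE enormN enormZ e1 mulr1 ger0_norm.
have x'E : x' - (x + s *: e) = - ((enorm (x - x') + s) *: e).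
  by rewrite scalerDl -eD; apply/rowP => i; rewrite !mxE; ring.
rewrite /eball /= x'E enormN enormZ e1 mulr1 ger0_norm; first lra.
by rewrite addr_ge0 ?enorm_ge0.
Qed.

(** * The skeleton and its relation to unique nearest points *)

Lemma skeleton_unpp_interiorF (R : realType) (d : nat) (M : set 'rV[R]_d)
    (x : 'rV[R]_d) :
  M !=set0 -> skeleton (~` M) x -> ~ unpp_interior M x.
Proof.
move=> M0 [r [r0 [/eball_subC rM rmax]]] xM.
have {}rM := rM M0.
have cM0 : closure M !=set0.
  by have [p Mp] := M0; exists p; exact: subset_closure.
have /nbhs_eball[e e0 eM] : nbhs x (unpp_interior M).
  by apply: open_nbhs_nbhs; split=> //; exact: open_interior.
have [||||y [yx]] := @edist_ascent_ray _ _ (closure M) x (e / 2) _ cM0.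
- exact: closed_closure.
- by rewrite divr_gt0.
- by rewrite edist_closure //; exact: lt_le_trans rM.
- move=> y p q xy yp yq.
  have yM : unpp_interior M y.
    by apply: eM; move: xy; rewrite /eball /ecball /=; lra.
  have [a [_ ua]] := interior_subset yM.
  have nearM := unpp_interior_nearest_closure M0 yM.
  by apply: (etrans (esym (ua p (nearM p yp)))); exact: ua q (nearM q yq).
rewrite !edist_closure // => xy.
have [|||_ yx'] := rmax y (edist y M).
- by have := enorm_ge0 (x - y); lra.
- by apply: eball_sub; lra.
- exact/eball_subC.
by move: yx; rewrite yx' eqxx.
Qed.

(** A ball avoiding [M], with center [x'] other than [x] and containing the ball around [x], leaves
    room on the sphere around [x] for one point of [M] only, the one farthest from [x']. *)
Lemma two_nearest_points_skeleton (R : realType) (d : nat) (M : set 'rV[R]_d)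
    (x p q : 'rV[R]_d) :
  nearest_point M x p -> nearest_point M x q -> p != q -> skeleton (~` M) x.
Proof.
move=> [Mp xp] [Mq xq] pq.
have M0 : M !=set0 by exists p.
have r0 : 0 < edist x M.
  rewrite lt_def -{2}xp enorm_ge0 andbT; apply: contra_neq pq => r0.
  move: xp xq; rewrite r0 => /enorm_eq0/subr0_eq <- /enorm_eq0/subr0_eq <-.
  by [].
exists (edist x M); split=> //; split; first exact/eball_subC.
move=> x' r' r'0 xx' /(eball_subC _ _ M0) r'M.
have xr' : enorm (x - x') + edist x M <= r'.
  by apply: (@eball_sub_inv _ _ (p - q)) xx'; rewrite ?subr_eq0.
have [/subr0_eq xx'0|w0] := eqVneq (x - x') 0.
  split=> //; apply/eqP; rewrite eq_le {1}xx'0 r'M /=.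
  by apply: le_trans xr'; rewrite lerDr enorm_ge0.
have D0 := enorm_gt0 w0.
set D := enorm (x - x') in xr' D0; set r := edist x M in r0 xp xq xr'.
(* The point of the sphere around x farthest from x' *)
pose a := x + (r / D) *: (x - x').
suff eqa b : M b -> enorm (x - b) = r -> b = a.
  by move: pq; rewrite (eqa p) // (eqa q) // eqxx.
move=> Mb xb.
have Dr : 0 < D + r by rewrite addr_gt0.
have x'a : enorm (x' - a) = D + r.
  have -> : x' - a = - ((1 + r / D) *: (x - x')).
    by apply/rowP => i; rewrite !mxE; ring.
  rewrite enormN enormZ ger0_norm; last by rewrite addr_ge0 // divr_ge0 // ltW.
  by rewrite -/D; field; rewrite gt_eqF.
(* The center [x] divides the segment from [x'] to [a] in the ratio [D] to [r]. *)
apply: (@dist_segment_eq _ _ x' b a (D / (D + r))).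
- by rewrite divr_gt0.
- by rewrite ler_pdivrMr // mul1r lerDl ltW.
- rewrite x'a; apply: le_trans xr' (le_trans r'M _); exact: edist_le.
have -> : x' + D / (D + r) *: (a - x') = x.
  apply/rowP => i; rewrite !mxE; field.
  by rewrite !gt_eqF.
rewrite xb x'a.
have -> : (1 - D / (D + r)) * (D + r) = r by field; rewrite gt_eqF.
by [].
Qed.

(** Open balls avoid [M] and its closure alike, both having the same distance function. *)
Lemma skeletonC_closure (R : realType) (d : nat) (M : set 'rV[R]_d) :
  M !=set0 -> skeleton (~` closure M) = skeleton (~` M).
Proof.
move=> M0; have cM0 : closure M !=set0.
  by have [p Mp] := M0; exists p; exact: subset_closure.
have subE x r : eball x r `<=` ~` closure M <-> eball x r `<=` ~` M.
  by rewrite !eball_subC // edist_closure.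
apply/seteqP; split=> x [r [r0 [/subE rM rmax]]]; exists r; split=> //;
  by split=> // x' r' r'0 xx' /subE r'M; exact: rmax.
Qed.

Theorem proposition8 (R : realType) (d : nat) (M : set 'rV[R]_d) (hM : M !=set0) :
  ~` (unpp_interior M) =
    closure (skeleton (~` M)) `|` closure (no_nearest_point M) /\
  closure (skeleton (~` M)) `|` closure (no_nearest_point M) =
    closure (skeleton (~` closure M)) `|` closure (no_nearest_point M).
Proof.
split; last by rewrite skeletonC_closure.
rewrite -closureU; apply/seteqP; split.
  rewrite /unpp_interior -closure_setC; apply: closure_subset => x nx.
  have [[p xp]|nn] := pselect (exists p, nearest_point M x p); last by right.
  left; apply: contrapT => nS; apply: nx; exists p; split=> // q xq.
  have [//|pq] := eqVneq p q.
  by case: nS; exact: two_nearest_points_skeleton xp xq pq.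
have cE : closed (~` unpp_interior M).
  exact/open_closedC/open_interior.
(* The left side is closed, so it suffices to treat the two sets before closure. *)
rewrite [X in _ `<=` X](closure_id _).1 //; apply: closure_subset => x [xS|nn].
  exact: skeleton_unpp_interiorF.
by move=> /interior_subset[p [xp _]]; apply: nn; exists p.
Qed.
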